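(* Let $m\geq 0$ be an integer, put $N=6(m+1)^2$, and write $$\prod_{j=0}^{m}(1+q^{4j+1})(1+q^{4j+2})(1+q^{4j+3})=\sum_{n=0}^{N}d_{4,m}(n)\,q^n .$$ Then this polynomial is unimodal except at the coefficients of $q^4$ and $q^{6(m+1)^2-4}$; that is, $$d_{4,m}(n)\geq d_{4,m}(n-1)\quad\text{for all integers } 1\leq n\leq 3(m+1)^2 \text{ with } n\neq 4,$$ and $$d_{4,m}(n)\geq d_{4,m}(n+1)\quad\text{for all integers } 3(m+1)^2\leq n\leq N-1 \text{ with } n\neq N-4.$$
   Context: A polynomial $a_0+a_1q+\cdots+a_Nq^N$ with integer coefficients is called unimodal if for some $0\leq j\leq N$ one has $a_0\leq a_1\leq\cdots\leq a_j\geq a_{j+1}\geq\cdots\geq a_N$. The phrase ''unimodal except at the coefficients of $q^4$ and $q^{6(m+1)^2-4}$'' has the explicit meaning given in the claim. *)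

(* Defs.v *)
From mathcomp Require Import all_boot all_order all_algebra.
From mathcomp Require Import zify.

Set Implicit Arguments.
Unset Strict Implicit.
Unset Printing Implicit Defensive.

Import Order.TTheory GRing.Theory Num.Theory.
Local Open Scope ring_scope.

Definition P4 (m : nat) : {poly int} :=
  \prod_(j < m.+1)
    ((1 + 'X^(4 * j + 1)) * (1 + 'X^(4 * j + 2)) * (1 + 'X^(4 * j + 3))).

Definition d4 (m n : nat) : int := (P4 m)`_n.

Definition N4 (m : nat) : nat := (6 * m.+1 ^ 2)%N.

Lemma size_P4 (m : nat) : size (P4 m) = (N4 m).+1.
Proof.
have sz k : (0 < k)%N -> size (1 + 'X^k : {poly int}) = k.+1.
  by move=> k0; rewrite addrC size_polyDl ?size_polyXn // size_poly1.
have nz k : (0 < k)%N -> (1 + 'X^k : {poly int}) != 0.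
  by move=> k0; rewrite -size_poly_eq0 sz.
have szf j : size ((1 + 'X^(4 * j + 1)) * (1 + 'X^(4 * j + 2)) *
    (1 + 'X^(4 * j + 3)) : {poly int}) = (12 * j + 7)%N.
  by rewrite !size_mul ?mulf_neq0 ?nz ?sz //; lia.
rewrite /P4 /N4; elim: m => [|m IHm].
  by rewrite big_ord_recr big_ord0 /= mul1r szf.
rewrite big_ord_recr /= size_mul ?IHm ?szf; [nia| |].
  by rewrite -size_poly_eq0 IHm.
by rewrite -size_poly_eq0 szf; lia.
Qed.

Lemma P4_expansion (m : nat) :
  P4 m = \sum_(n < (N4 m).+1) d4 m n *: 'X^n.
Proof. by rewrite -size_P4 -poly_def coefK. Qed.

(* Main.v *)
(** Write [M = m + 1] and let [c_M(n)] be the coefficient of [q^n] in [1 - q]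
    times the product.  The claim is [c_M(n) >= 0] for [1 <= n <= 3 M^2],
    [n <> 4]; the second half follows since the product is palindromic.

    Passing from [M] to [M + 1] writes [c_{M+1}(n)] as a sum of eight shifted
    values of [c_M], so [c_M >= 1] on [[8, 3 M^2]] propagates to [c_{M+1}] on the
    same interval.  On the remaining window [3 M^2 < n <= 3 (M+1)^2] next to the
    centre, positivity comes from Fourier inversion at the [L]-th roots of unity,
    [L = 6 M^2 + 1] for the larger [M]: up to a positive factor, [c_M(3 M^2 - x)]
    is the sum over [1 <= k <= 3 M^2], with [t = 2 pi k / L], of
      [prod_j cos (j t / 2) * sin (t / 2) * sin ((x + 1/2) t)].
    Terms with [t <= pi / (6 M)] are nonnegative.  For larger [t] the mean of
    [cos (j t)] over the parts is at most [0.42], so AM-GM bounds the product by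
    [(3/5)^M]; as [|sin (k u)| <= k |sin u|], those terms are at most
    [k^2 (3/5)^M] times the sines of the term [k = 1], which therefore dominates
    once [M >= 54].  The cases [M <= 54] are computed. *)

From Stdlib Require Import ZArith Reals List Lia Lra.
Import ListNotations.

(** * Subset-sum counts and the recursion over blocks *)

Local Open Scope Z_scope.

(** The coefficient of [q^n] in the product of [1 + q^j] over [j] in [s]; with indices in [Z],
    shifts need no case distinction. *)
Fixpoint subset_count (s : list Z) (n : Z) : Z :=
  match s with
  | [] => if n =? 0 then 1 else 0
  | j :: s' => subset_count s' n + subset_count s' (n - j)
  end.

Definition subset_diff (s : list Z) (n : Z) : Z :=
  subset_count s n - subset_count s (n - 1).

Definition lsum (s : list Z) : Z := fold_right Z.add 0 s.

Fixpoint parts (M : nat) : list Z :=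
  match M with
  | O => []
  | S k => let a := 4 * Z.of_nat k + 1 in a :: a + 1 :: a + 2 :: parts k
  end.

Lemma subset_count_neg (s : list Z) (n : Z) :
  Forall (Z.le 0) s -> n < 0 -> subset_count s n = 0.
Proof.
intros hs; revert n; induction hs as [|j s hj hs IH]; intros n hn; simpl.
- destruct (Z.eqb_spec n 0); lia.
- rewrite !IH; lia.
Qed.

Lemma subset_diff_neg (s : list Z) (n : Z) :
  Forall (Z.le 0) s -> n < 0 -> subset_diff s n = 0.
Proof. intros; unfold subset_diff; rewrite !subset_count_neg; auto; lia. Qed.

Lemma subset_diff_cons (j : Z) (s : list Z) (n : Z) :
  subset_diff (j :: s) n = subset_diff s n + subset_diff s (n - j).
Proof.
unfold subset_diff; simpl.
replace (n - 1 - j) with (n - j - 1) by ring; ring.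
Qed.

(** Complementing a subset reflects its sum; this is the palindromic symmetry of the product. *)
Lemma subset_count_sym (s : list Z) (n : Z) :
  subset_count s (lsum s - n) = subset_count s n.
Proof.
revert n; induction s as [|j s IH]; intros n;
  cbn [subset_count lsum fold_right].
- destruct (Z.eqb_spec (0 - n) 0), (Z.eqb_spec n 0); lia.
- fold (lsum s).
  replace (j + lsum s - n) with (lsum s - (n - j)) by ring.
  replace (lsum s - (n - j) - j) with (lsum s - n) by ring.
  rewrite !IH; ring.
Qed.

Lemma parts_nonneg (M : nat) : Forall (Z.le 0) (parts M).
Proof.
induction M as [|M IH]; [constructor|].
cbn [parts]; repeat (constructor; [lia|]); exact IH.
Qed.

Lemma parts_le (M : nat) : Forall (fun j => 0 <= j <= 4 * Z.of_nat M - 1) (parts M).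
Proof.
induction M as [|M IH]; [constructor|].
cbn [parts]; do 3 (constructor; [lia|]).
eapply Forall_impl; [|exact IH]; cbv beta; lia.
Qed.

Lemma lsum_parts (M : nat) : lsum (parts M) = 6 * Z.of_nat M ^ 2.
Proof.
induction M as [|M IH]; [reflexivity|].
unfold lsum in *; cbn [parts fold_right]; rewrite IH; lia.
Qed.

Lemma length_parts (M : nat) : length (parts M) = (3 * M)%nat.
Proof. induction M as [|M IH]; [reflexivity|]; cbn [parts length]; lia. Qed.

(** The shifts are the subset sums of [a], [a + 1], [a + 2], grouped by subset size; sizes one and
    two give three consecutive indices each. *)
Lemma parts_diff_S (M : nat) (n : Z) :
  let c := subset_diff (parts M) in
  let a := 4 * Z.of_nat M + 1 in
  subset_diff (parts (S M)) n =
    c n + (c (n - a) + c (n - a - 1) + c (n - a - 2))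
    + (c (n - 2 * a - 1) + c (n - 2 * a - 2) + c (n - 2 * a - 3))
    + c (n - 3 * a - 3).
Proof.
intros c a; cbn [parts]; rewrite !subset_diff_cons; fold a; unfold c.
replace (n - (a + 1)) with (n - a - 1) by ring.
replace (n - (a + 2)) with (n - a - 2) by ring.
replace (n - a - 1 - (a + 2)) with (n - 2 * a - 3) by ring.
replace (n - a - (a + 1)) with (n - 2 * a - 1) by ring.
replace (n - a - (a + 2)) with (n - 2 * a - 2) by ring.
replace (n - 2 * a - 1 - (a + 2)) with (n - 3 * a - 3) by ring.
ring.
Qed.

(** After two blocks every new part is at least 9, so the coefficients up to [q^7] no longer
    change. *)
Lemma parts_diff_small (M : nat) : (2 <= M)%nat ->
  let c := subset_diff (parts M) in
  c 0 = 1 /\ c 1 = 0 /\ c 2 = 0 /\ c 3 = 1 /\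
  c 4 = -1 /\ c 5 = 1 /\ c 6 = 1 /\ c 7 = 0.
Proof.
intros hM c; unfold c; clear c; induction hM as [|M hM IH].
- now vm_compute.
- assert (E : forall n, n <= 7 ->
    subset_diff (parts (S M)) n = subset_diff (parts M) n).
  { intros n hn; rewrite parts_diff_S.
    repeat match goal with |- context [subset_diff (parts M) (?x - ?y)] =>
      rewrite (subset_diff_neg _ (x - y) (parts_nonneg M)) by lia end; lia. }
  rewrite !E by lia; exact IH.
Qed.

(* Strict positivity from 8 on is what absorbs the exceptional value -1 at 4. *)
Lemma parts_diff_step (M : nat) : (2 <= M)%nat ->
  (forall n, 8 <= n <= 3 * Z.of_nat M ^ 2 -> 1 <= subset_diff (parts M) n) ->
  forall n, 8 <= n <= 3 * Z.of_nat M ^ 2 -> 1 <= subset_diff (parts (S M)) n.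
Proof.
intros hM H n hn; rewrite parts_diff_S.
destruct (parts_diff_small M hM) as (c0 & c1 & c2 & c3 & c4 & c5 & c6 & c7).
pose proof (fun k => subset_diff_neg _ k (parts_nonneg M)) as cneg.
set (c := subset_diff (parts M)) in *.
set (a := 4 * Z.of_nat M + 1) in *.
assert (ha : 9 <= a) by lia.
assert (hM2 : 12 <= 3 * Z.of_nat M ^ 2) by nia.
set (B := 3 * Z.of_nat M ^ 2) in *.
assert (single : forall u, u <= B -> u <> 4 -> 0 <= c u).
{ intros u hu h4.
  destruct (Z.lt_ge_cases u 0); [rewrite cneg; lia|].
  destruct (Z.le_gt_cases 8 u); [specialize (H u); lia|].
  assert (u = 0 \/ u = 1 \/ u = 2 \/ u = 3 \/ u = 5 \/ u = 6 \/ u = 7) as D by lia.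
  repeat destruct D as [->|D]; lia || (subst u; lia). }
(* In any three consecutive indices containing 4, the value 1 at 3 or at 5 compensates the -1. *)
assert (triple : forall u, u <= B -> 0 <= c u + c (u - 1) + c (u - 2)).
{ intros u hu.
  destruct (Z.eq_dec u 4) as [->|]; [simpl; lia|].
  destruct (Z.eq_dec u 5) as [->|]; [simpl; lia|].
  destruct (Z.eq_dec u 6) as [->|]; [simpl; lia|].
  pose proof (single u); pose proof (single (u - 1)); pose proof (single (u - 2)); lia. }
pose proof (triple (n - a)) as t1.
pose proof (triple (n - 2 * a - 1)) as t2.
replace (n - 2 * a - 1 - 1) with (n - 2 * a - 2) in t2 by ring.
replace (n - 2 * a - 1 - 2) with (n - 2 * a - 3) in t2 by ring.
pose proof (H n hn) as h0.
(* Only the last, isolated shift can meet the -1 alone; then the indices of the second triple are at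
   least [a + 4], hence above 8, and contribute 3. *)
destruct (Z.eq_dec (n - 3 * a - 3) 4) as [e|ne].
- pose proof (H (n - 2 * a - 1)); pose proof (H (n - 2 * a - 2)).
  pose proof (H (n - 2 * a - 3)).
  rewrite e, c4; lia.
- pose proof (single (n - 3 * a - 3)); lia.
Qed.

(** * Computation of the first cases *)

Fixpoint add_lists (l1 l2 : list Z) : list Z :=
  match l1, l2 with
  | [], _ => l2
  | _, [] => l1
  | x :: l1', y :: l2' => x + y :: add_lists l1' l2'
  end.

Fixpoint shift_list (j : nat) (l : list Z) : list Z :=
  match j with O => l | S j' => 0 :: shift_list j' l end.

Definition mul_part (j : nat) (l : list Z) : list Z :=
  add_lists l (shift_list j l).

(* [l] lists the coefficients of [1 - q] times the product of the first [M] blocks;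
   zero differences beyond [q^7] occur for two, three and four blocks only. *)
Fixpoint check_diffs (k M : nat) (l : list Z) : bool :=
  match k with
  | O => true
  | S k' =>
    let l' := mul_part (4 * M + 1) (mul_part (4 * M + 2) (mul_part (4 * M + 3) l)) in
    let b := if (4 <=? M)%nat then 1 else 0 in
    (3 * (S M * S M) <? length l')%nat
      && forallb (fun z => b <=? z) (skipn 8 (firstn (3 * (S M * S M) + 1) l'))
      && check_diffs k' (S M) l'
  end.

Definition represents (l : list Z) (s : list Z) : Prop :=
  forall n : nat, nth n l 0 = subset_diff s (Z.of_nat n).

Lemma nth_add_lists (l1 l2 : list Z) (n : nat) :
  nth n (add_lists l1 l2) 0 = nth n l1 0 + nth n l2 0.
Proof.
revert l2 n; induction l1 as [|x l1 IH]; intros [|y l2] [|n]; simpl; auto; lia.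
Qed.

Lemma nth_shift_list (j : nat) (l : list Z) (n : nat) :
  nth n (shift_list j l) 0 = if (j <=? n)%nat then nth (n - j) l 0 else 0.
Proof.
revert n; induction j as [|j IH]; intros n; simpl; [now rewrite Nat.sub_0_r|].
destruct n as [|n]; simpl; auto.
Qed.

Lemma represents_mul_part (j : nat) (z : Z) (l s : list Z) :
  Forall (Z.le 0) s -> z = Z.of_nat j -> represents l s ->
  represents (mul_part j l) (z :: s).
Proof.
intros hs -> hl n; unfold mul_part.
rewrite nth_add_lists, nth_shift_list, subset_diff_cons, hl; f_equal.
destruct (Nat.leb_spec j n).
- rewrite hl; f_equal; lia.
- rewrite subset_diff_neg; auto; lia.
Qed.

Lemma represents_parts_S (M : nat) (l : list Z) : represents l (parts M) ->
  represents
    (mul_part (4 * M + 1) (mul_part (4 * M + 2) (mul_part (4 * M + 3) l)))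
    (parts (S M)).
Proof.
intros hl; cbn [parts]; pose proof (parts_nonneg M).
repeat apply represents_mul_part; repeat constructor; auto; lia.
Qed.

Lemma check_diffs_sound (k M : nat) (l : list Z) :
  represents l (parts M) -> check_diffs k M l = true ->
  forall M', (M < M' <= M + k)%nat ->
  forall n, 8 <= n <= 3 * Z.of_nat M' ^ 2 ->
  (if (5 <=? M')%nat then 1 else 0) <= subset_diff (parts M') n.
Proof.
revert M l; induction k as [|k IH]; intros M l hl hc M' hM' n hn; [lia|].
cbn [check_diffs] in hc; rewrite !Bool.andb_true_iff, Nat.ltb_lt in hc.
destruct hc as [[hlen hf] hc].
pose proof (represents_parts_S M l hl) as hl'.
set (l' := mul_part _ _) in *.
destruct (Nat.eq_dec M' (S M)) as [->|]; [|apply (IH (S M) l' hl' hc); lia].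
change (5 <=? S M)%nat with (4 <=? M)%nat.
rewrite forallb_forall in hf.
set (b := if (4 <=? M)%nat then 1 else 0) in *.
replace n with (Z.of_nat (Z.to_nat n)) by lia.
rewrite <- hl'; apply Z.leb_le, hf.
set (i := Z.to_nat n).
assert (hi : (8 <= i < 3 * (S M * S M) + 1)%nat) by (unfold i; nia).
(* Entry [i] of [l'] is entry [i - 8] of the tested slice; the length test guarantees that it lies
   there and is no default value. *)
replace (nth i l' 0)
  with (nth (i - 8) (skipn 8 (firstn (3 * (S M * S M) + 1) l')) 0).
- apply nth_In; rewrite length_skipn, length_firstn; lia.
- rewrite nth_skipn, nth_firstn.
  replace (8 + (i - 8))%nat with i by lia.
  now rewrite (proj2 (Nat.ltb_lt _ _) (proj2 hi)).
Qed.

(** The initial list is [1 - q] itself, the case of no blocks; one evaluation covers all [M] from 1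
    to 54. *)
Lemma check_diffs_54 : check_diffs 54 0 [1; -1] = true.
Proof. vm_cast_no_check (eq_refl true). Qed.

Lemma represents_nil : represents [1; -1] [].
Proof.
intros [|[|n]]; try reflexivity.
rewrite nth_overflow by (simpl; lia); unfold subset_diff, subset_count.
destruct (Z.eqb_spec (Z.of_nat (S (S n))) 0), (Z.eqb_spec (Z.of_nat (S (S n)) - 1) 0); lia.
Qed.

Lemma parts_diff_upto_54 (M : nat) (n : Z) : (0 < M <= 54)%nat ->
  8 <= n <= 3 * Z.of_nat M ^ 2 ->
  (if (5 <=? M)%nat then 1 else 0) <= subset_diff (parts M) n.
Proof.
intros hM; exact (check_diffs_sound 54 0 _ represents_nil check_diffs_54 M hM n).
Qed.

Close Scope Z_scope.
Local Open Scope R_scope.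

(** * Fourier inversion *)

Fixpoint rsum (f : nat -> R) (n : nat) : R :=
  match n with O => 0 | S n' => rsum f n' + f n' end.

Lemma rsum_ext (f g : nat -> R) (n : nat) :
  (forall k, (k < n)%nat -> f k = g k) -> rsum f n = rsum g n.
Proof.
induction n as [|n IH]; intros h; simpl; [easy|].
rewrite IH, h by auto; reflexivity.
Qed.

Lemma rsum_scal (a : R) (f : nat -> R) (n : nat) :
  rsum (fun k => a * f k) n = a * rsum f n.
Proof. induction n as [|n IH]; simpl; [|rewrite IH]; ring. Qed.

Lemma rsum_1 (n : nat) : rsum (fun _ => 1) n = INR n.
Proof. induction n as [|n IH]; [reflexivity|]; rewrite S_INR, <- IH; reflexivity. Qed.

Lemma rsum_sub (f g : nat -> R) (n : nat) :
  rsum (fun k => f k - g k) n = rsum f n - rsum g n.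
Proof. induction n as [|n IH]; simpl; [|rewrite IH]; ring. Qed.

(** Since [x^2 <= ((x + 1)^3 - x^3) / 3], the quadratic error bounds add up to at most a third of a
    cube. It serves to let the first Fourier term outweigh the rest. *)
Lemma rsum_dominated (f : nat -> R) (A B : R) (n : nat) :
  A <= f 0%nat ->
  (forall k, (k <= n)%nat -> - (B * INR (S k) ^ 2) <= f k) -> 0 <= B ->
  A - B * (INR (S (S n)) ^ 3 / 3) <= rsum f (S n).
Proof.
intros hA hf hB; induction n as [|n IH].
- simpl rsum; simpl INR; nra.
- specialize (IH (fun k hk => hf k (Nat.le_le_succ_r _ _ hk))).
  specialize (hf (S n) (Nat.le_refl _)).
  cbn [rsum] in *.
  rewrite (S_INR (S (S n))).
  pose proof (pos_INR (S (S n))).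
  set (x := INR (S (S n))) in *.
  assert (B * ((x + 1) ^ 3 / 3) >= B * (x ^ 3 / 3) + B * x ^ 2) by nra.
  lra.
Qed.

(* The sum of [g] over the subset sums of [s], with multiplicity. *)
Fixpoint subset_fold (s : list Z) (g : Z -> R) : R :=
  match s with
  | [] => g 0%Z
  | j :: s' => subset_fold s' g + subset_fold s' (fun x => g (x + j)%Z)
  end.

Lemma subset_fold_ext (s : list Z) (g h : Z -> R) :
  Forall (Z.le 0) s ->
  (forall x, (0 <= x <= lsum s)%Z -> g x = h x) ->
  subset_fold s g = subset_fold s h.
Proof.
intros hs; revert g h; induction hs as [|j s hj hs IH]; intros g h e; simpl.
- apply e; simpl; lia.
- change (lsum (j :: s)) with (j + lsum s)%Z in e.
  f_equal; apply IH; intros x hx; apply e; lia.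
Qed.

Lemma subset_fold_affine (s : list Z) (a b : R) (g h : Z -> R) :
  subset_fold s (fun x => a * g x + b * h x) =
  a * subset_fold s g + b * subset_fold s h.
Proof.
revert g h; induction s as [|j s IH]; intros g h; simpl; [easy|].
rewrite IH, (IH (fun x => g (x + j)%Z) (fun x => h (x + j)%Z)); ring.
Qed.

Lemma subset_fold_0 (s : list Z) : subset_fold s (fun _ => 0) = 0.
Proof. induction s as [|j s IH]; simpl; [|rewrite IH]; ring. Qed.

Lemma subset_fold_rsum (s : list Z) (g : nat -> Z -> R) (n : nat) :
  subset_fold s (fun x => rsum (fun k => g k x) n) =
  rsum (fun k => subset_fold s (g k)) n.
Proof.
induction n as [|n IH]; simpl; [apply subset_fold_0|].
rewrite <- IH.
transitivity (1 * subset_fold s (fun x => rsum (fun k => g k x) n)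
              + 1 * subset_fold s (g n)); [|ring].
rewrite <- subset_fold_affine; f_equal.
apply FunctionalExtensionality.functional_extensionality; intros x; ring.
Qed.

Lemma subset_fold_indicator (s : list Z) (n : Z) (b : R) :
  subset_fold s (fun x => if (x =? n)%Z then b else 0) =
  b * IZR (subset_count s n).
Proof.
revert n; induction s as [|j s IH]; intros n; cbn [subset_fold subset_count].
- rewrite (Z.eqb_sym n 0); destruct (0 =? n)%Z; lra.
- rewrite plus_IZR, Rmult_plus_distr_l, <- !IH; f_equal; f_equal.
  apply FunctionalExtensionality.functional_extensionality; intros x.
  destruct (Z.eqb_spec (x + j) n), (Z.eqb_spec x (n - j)); auto; lia.
Qed.

Definition cos_prod (s : list Z) (t : R) : R :=
  fold_right (fun j p => cos (IZR j * t / 2) * p) 1 s.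

(** Real form of [1 + e^(ijt) = 2 cos (jt/2) e^(ijt/2)], multiplied over [s]; the free phase [u]
    carries the induction. *)
Lemma subset_fold_cos (s : list Z) (t u : R) :
  subset_fold s (fun x => cos (IZR x * t - u)) =
  2 ^ length s * cos_prod s t * cos (IZR (lsum s) * t / 2 - u).
Proof.
revert u; induction s as [|j s IH]; intros u.
- simpl; replace (0 * t / 2 - u) with (0 * t - u) by field; ring.
- change (lsum (j :: s)) with (j + lsum s)%Z.
  cbn [subset_fold length cos_prod fold_right]; fold (cos_prod s t).
  rewrite IH.
  replace (fun x => cos (IZR (x + j) * t - u))
    with (fun x => cos (IZR x * t - (u - IZR j * t))).
  2:{ apply FunctionalExtensionality.functional_extensionality; intros x.
      rewrite plus_IZR; f_equal; ring. }
  rewrite IH, plus_IZR.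
  set (y := (IZR j + IZR (lsum s)) * t / 2 - u).
  set (w := IZR j * t / 2).
  replace (IZR (lsum s) * t / 2 - u) with (y - w) by (unfold y, w; field).
  replace (IZR (lsum s) * t / 2 - (u - IZR j * t)) with (y + w)
    by (unfold y, w; field).
  rewrite cos_plus, cos_minus; simpl; ring.
Qed.

Lemma sin_IZR_PI_frac_neq0 (d L : Z) :
  (0 < d < L)%Z -> sin (PI * IZR d / IZR L) <> 0.
Proof.
intros [h1 h2].
apply IZR_lt in h1; apply IZR_lt in h2.
assert (0 < IZR d / IZR L < 1).
{ split; [apply Rdiv_lt_0_compat; lra|].
  apply (Rmult_lt_reg_r (IZR L)); [lra|]; field_simplify; lra. }
apply Rgt_not_eq, sin_gt_0; unfold Rdiv in *; pose proof PI_RGT_0; nra.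
Qed.

Lemma sin_IZR_PI (d : Z) : sin (PI * IZR d) = 0.
Proof. apply sin_eq_0_1; exists d; ring. Qed.

(** Each [2 sin u cos (2ku)] is [sin ((2k+1)u) - sin ((2k-1)u)]. *)
Lemma dirichlet_telescope (u : R) (n : nat) :
  sin u * (1 + 2 * rsum (fun k => cos (2 * INR (S k) * u)) n) =
  sin ((2 * INR n + 1) * u).
Proof.
induction n as [|n IH].
- simpl; replace ((2 * 0 + 1) * u) with u by ring; ring.
- cbn [rsum].
  replace (sin u * _)
    with (sin ((2 * INR n + 1) * u) + 2 * sin u * cos (2 * INR (S n) * u))
    by (rewrite <- IH; ring).
  rewrite S_INR; set (w := 2 * (INR n + 1) * u).
  replace ((2 * INR n + 1) * u) with (w - u) by (unfold w; ring).
  replace ((2 * (INR n + 1) + 1) * u) with (w + u) by (unfold w; ring).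
  rewrite sin_minus, sin_plus; ring.
Qed.

(** Orthogonality of the roots of unity of odd order [2H + 1], with conjugate roots paired. As
    [|x - n| <= 2H], congruence modulo [2H + 1] means equality. *)
Lemma dirichlet_kernel (H : nat) (x n : Z) :
  (Z.abs (x - n) <= 2 * Z.of_nat H)%Z ->
  1 + 2 * rsum (fun k => cos (IZR x * (2 * PI * INR (S k) / (2 * INR H + 1))
                  - IZR n * (2 * PI * INR (S k) / (2 * INR H + 1)))) H =
  if (x =? n)%Z then 2 * INR H + 1 else 0.
Proof.
intros hx.
pose proof (pos_INR H) as hH.
destruct (Z.eqb_spec x n) as [->|ne].
- rewrite (rsum_ext _ (fun _ => 1)), rsum_1; [ring|].
  intros k _; rewrite Rminus_diag; apply cos_0.
- set (d := Z.abs (x - n)).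
  set (u := PI * IZR d / (2 * INR H + 1)).
  assert (e : forall k, cos (IZR x * (2 * PI * INR (S k) / (2 * INR H + 1))
      - IZR n * (2 * PI * INR (S k) / (2 * INR H + 1))) = cos (2 * INR (S k) * u)).
  { intros k; rewrite <- Rmult_minus_distr_r, <- minus_IZR.
    unfold u, d; destruct (Z.abs_eq_or_opp (x - n)) as [->| ->].
    - f_equal; field; lra.
    - rewrite <- cos_neg, opp_IZR; f_equal; field; lra. }
  rewrite (rsum_ext _ _ H (fun k _ => e k)).
  assert (hL : 2 * INR H + 1 = IZR (2 * Z.of_nat H + 1))
    by (rewrite plus_IZR, mult_IZR, <- INR_IZR_INZ; reflexivity).
  apply (Rmult_eq_reg_l (sin u)).
  + rewrite dirichlet_telescope, Rmult_0_r.
    replace ((2 * INR H + 1) * u) with (PI * IZR d) by (unfold u; field; lra).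
    apply sin_IZR_PI.
  + unfold u; rewrite hL; apply sin_IZR_PI_frac_neq0; unfold d; lia.
Qed.

Lemma subset_count_fourier (s : list Z) (H : nat) (n : Z) :
  Forall (Z.le 0) s -> (lsum s <= 2 * Z.of_nat H)%Z ->
  (0 <= n <= 2 * Z.of_nat H)%Z ->
  let t k := 2 * PI * INR (S k) / (2 * INR H + 1) in
  (2 * INR H + 1) * IZR (subset_count s n) =
  2 ^ length s * (1 + 2 * rsum (fun k =>
    cos_prod s (t k) * cos ((IZR (lsum s) / 2 - IZR n) * t k)) H).
Proof.
intros hs hsum hn t.
rewrite <- subset_fold_indicator.
(* The constant term of the kernel is written as a cosine of frequency 0, so that [subset_fold_cos]
   evaluates it too. *)
rewrite (subset_fold_ext s _ (fun x => 1 * cos (IZR x * 0 - 0) +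
  2 * rsum (fun k => cos (IZR x * t k - IZR n * t k)) H) hs).
2:{ intros x hx; unfold t; rewrite <- dirichlet_kernel by lia.
    replace (IZR x * 0 - 0) with 0 by ring; rewrite cos_0; ring. }
rewrite subset_fold_affine, subset_fold_cos.
rewrite (subset_fold_rsum s (fun k x => cos (IZR x * t k - IZR n * t k))).
replace (IZR (lsum s) * 0 / 2 - 0) with 0 by field.
replace (cos_prod s 0) with 1.
2:{ clear; induction s as [|j s IH]; [reflexivity|].
    cbn [cos_prod fold_right]; fold (cos_prod s 0); rewrite <- IH.
    replace (IZR j * 0 / 2) with 0 by field; rewrite cos_0; ring. }
rewrite (rsum_ext _ (fun k => 2 ^ length s *
  (cos_prod s (t k) * cos ((IZR (lsum s) / 2 - IZR n) * t k)))).
2:{ intros k _; rewrite subset_fold_cos, Rmult_assoc.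
    do 3 f_equal; field. }
rewrite rsum_scal, cos_0; ring.
Qed.

(** The constant terms cancel, and the cosines for [n] and [n - 1] are [cos (y - t/2)] and
    [cos (y + t/2)] with a common midpoint [y], so they differ by [2 sin y sin (t/2)]. *)
Lemma subset_diff_fourier (s : list Z) (H : nat) (n : Z) :
  Forall (Z.le 0) s -> (lsum s <= 2 * Z.of_nat H)%Z ->
  (1 <= n <= 2 * Z.of_nat H)%Z ->
  let t k := 2 * PI * INR (S k) / (2 * INR H + 1) in
  (2 * INR H + 1) * IZR (subset_diff s n) =
  2 ^ length s * 4 * rsum (fun k =>
    cos_prod s (t k) *
    (sin (t k / 2) * sin ((IZR (lsum s) / 2 - IZR n + / 2) * t k))) H.
Proof.
intros hs hsum hn t; unfold subset_diff.
rewrite minus_IZR, Rmult_minus_distr_l.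
rewrite !(subset_count_fourier s H) by (auto; lia).
rewrite <- Rmult_minus_distr_l.
match goal with |- _ * (1 + 2 * rsum ?f H - (1 + 2 * rsum ?g H)) = _ =>
  replace (1 + 2 * rsum f H - (1 + 2 * rsum g H))
    with (2 * (rsum f H - rsum g H)) by ring end.
rewrite <- rsum_sub, (Rmult_assoc _ 4); f_equal; rewrite <- !rsum_scal.
apply rsum_ext; intros k _; fold (t k).
rewrite minus_IZR.
set (y := (IZR (lsum s) / 2 - IZR n + / 2) * t k).
replace ((IZR (lsum s) / 2 - IZR n) * t k) with (y - t k / 2)
  by (unfold y; field).
replace ((IZR (lsum s) / 2 - (IZR n - 1)) * t k) with (y + t k / 2)
  by (unfold y; field).
rewrite cos_minus, cos_plus; ring.
Qed.

Lemma Rabs_sin_mult (k : nat) (u : R) :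
  Rabs (sin (INR k * u)) <= INR k * Rabs (sin u).
Proof.
induction k as [|k IH].
- simpl; rewrite Rmult_0_l, sin_0, Rabs_R0; lra.
- rewrite S_INR, Rmult_plus_distr_r, Rmult_1_l, sin_plus.
  eapply Rle_trans; [apply Rabs_triang|]; rewrite !Rabs_mult.
  assert (b : forall v, Rabs (cos v) <= 1) by (intros; apply Rabs_le, COS_bound).
  pose proof (b u); pose proof (b (INR k * u)).
  pose proof (Rabs_pos (sin (INR k * u))); pose proof (Rabs_pos (sin u)).
  nra.
Qed.

(** * The central window *)

Definition cos_sum (s : list Z) (t : R) : R :=
  fold_right (fun j y => cos (IZR j * t) + y) 0 s.

(* AM-GM for the squares of the factors, through [1 + x <= exp x]. *)
Lemma cos_prod_sqr_le (s : list Z) (t a : R) : 0 < a ->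
  cos_prod s t ^ 2 <=
  a ^ length s * exp (((INR (length s) + cos_sum s t) / 2 - INR (length s) * a) / a).
Proof.
intros ha; induction s as [|j s IH].
- simpl; replace (((0 + 0) / 2 - 0 * a) / a) with 0 by (field; lra).
  rewrite exp_0; lra.
- cbn [cos_prod cos_sum fold_right length]; fold (cos_prod s t) (cos_sum s t).
  rewrite S_INR, Rpow_mult_distr.
  change (a ^ S (length s)) with (a * a ^ length s).
  set (y := cos (IZR j * t / 2) ^ 2).
  assert (hy : cos (IZR j * t) = 2 * y - 1).
  { replace (IZR j * t) with (2 * (IZR j * t / 2)) at 1 by field.
    rewrite cos_2a_cos; unfold y; ring. }
  rewrite hy.
  assert (h : y <= a * exp ((y - a) / a)).
  { apply Rle_trans with (a * (1 + (y - a) / a)); [right; field; lra|].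
    apply Rmult_le_compat_l; [lra|apply exp_ineq1_le]. }
  set (e := ((INR (length s) + cos_sum s t) / 2 - INR (length s) * a) / a) in *.
  replace (((INR (length s) + 1 + (2 * y - 1 + cos_sum s t)) / 2
            - (INR (length s) + 1) * a) / a) with ((y - a) / a + e)
    by (unfold e; field; lra).
  rewrite exp_plus.
  replace (a * a ^ length s * (exp ((y - a) / a) * exp e))
    with ((a * exp ((y - a) / a)) * (a ^ length s * exp e)) by ring.
  apply Rmult_le_compat; auto; apply pow2_ge_0.
Qed.

(** The squared factors are [(1 + cos (jt)) / 2]; if their mean is at most [a], the exponent in the
    previous bound is nonpositive. *)
Lemma cos_prod_sqr_le_pow (s : list Z) (t a : R) : 0 < a ->
  (INR (length s) + cos_sum s t) / 2 <= INR (length s) * a ->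
  cos_prod s t ^ 2 <= a ^ length s.
Proof.
intros ha h; eapply Rle_trans; [exact (cos_prod_sqr_le s t a ha)|].
rewrite <- (Rmult_1_r (a ^ length s)) at 2.
apply Rmult_le_compat_l; [apply pow_le; lra|].
set (z := _ / a).
assert (hz : z <= 0)
  by (apply (Rmult_le_reg_r a); [lra|]; unfold z; field_simplify; lra).
rewrite <- exp_0; destruct hz as [hz| ->]; [left; now apply exp_increasing|lra].
Qed.

(** The three cosines of a block are symmetric about the middle part [4k + 2]. *)
Lemma cos_sum_parts (M : nat) (t : R) :
  cos_sum (parts M) t =
  (1 + 2 * cos t) * rsum (fun k => cos ((4 * INR k + 2) * t)) M.
Proof.
induction M as [|M IH]; [simpl; ring|].
cbn [parts cos_sum fold_right rsum]; fold (cos_sum (parts M) t).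
rewrite IH, !plus_IZR, mult_IZR, <- INR_IZR_INZ.
set (w := (4 * INR M + 2) * t).
replace ((4 * INR M + 1) * t) with (w - t) by (unfold w; ring).
replace ((4 * INR M + 1 + 1) * t) with w by (unfold w; ring).
replace ((4 * INR M + 1 + 2) * t) with (w + t) by (unfold w; ring).
rewrite cos_minus, cos_plus; ring.
Qed.

Lemma cos_block_telescope (M : nat) (t : R) :
  2 * sin (2 * t) * rsum (fun k => cos ((4 * INR k + 2) * t)) M =
  sin (4 * INR M * t).
Proof.
induction M as [|M IH].
- simpl; replace (4 * 0 * t) with 0 by ring; rewrite sin_0; ring.
- cbn [rsum]; rewrite Rmult_plus_distr_l, IH, S_INR.
  set (w := (4 * INR M + 2) * t).
  replace (4 * INR M * t) with (w - 2 * t) by (unfold w; ring).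
  replace (4 * (INR M + 1) * t) with (w + 2 * t) by (unfold w; ring).
  rewrite sin_minus, sin_plus; ring.
Qed.

Lemma Rabs_cos_block_le (M : nat) (t : R) :
  Rabs (rsum (fun k => cos ((4 * INR k + 2) * t)) M) <= INR M.
Proof.
induction M as [|M IH]; [simpl; rewrite Rabs_R0; lra|].
cbn [rsum]; rewrite S_INR; eapply Rle_trans; [apply Rabs_triang|].
apply Rplus_le_compat; auto; apply Rabs_le, COS_bound.
Qed.

Lemma sin_ge_cubic (u : R) : 0 <= u <= 4 -> u - u ^ 3 / 6 <= sin u.
Proof.
intros [h1 h2]; destruct (pre_sin_bound u 0 h1 h2) as [h _].
eapply Rle_trans; [|exact h]; right.
unfold sin_approx, sin_term; simpl; field.
Qed.

(** Otherwise [cos (31/20) <= 0], against its Taylor lower bound of degree 6. *)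
Lemma PI_gt_31 : 31 / 10 < PI.
Proof.
apply Rnot_le_lt; intros h; pose proof PI2_3_2.
assert (hs : cos (31 / 20) <= 0) by (apply cos_le_0; lra).
destruct (pre_cos_bound (31 / 20) 1) as [hl _]; [lra|lra|].
revert hl; unfold cos_approx, cos_term; cbn -[INR].
rewrite !INR_IZR_INZ; cbn; lra.
Qed.

Lemma Rabs_le_bounds (x b : R) : Rabs x <= b -> - b <= x <= b.
Proof.
pose proof (Rle_abs x); pose proof (Rle_abs (- x)).
rewrite Rabs_Ropp in *; lra.
Qed.

(** There are [3M] parts, so the mean is at most 0.42. Near and beyond [PI / 2] the factor
    [1 + 2 cos t] is small; elsewhere the telescoped sum [sin (4Mt) / (2 sin (2t))] is bounded. *)
Lemma cos_sum_parts_le (M : nat) (t : R) : (54 <= M)%nat ->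
  PI / (6 * INR M) <= t <= PI ->
  cos_sum (parts M) t <= 126 / 100 * INR M.
Proof.
intros hM [h1 h2].
assert (hr : 54 <= INR M) by (apply le_INR in hM; simpl in hM; lra).
rewrite cos_sum_parts.
pose proof (Rabs_cos_block_le M t) as hU; apply Rabs_le_bounds in hU.
pose proof (cos_block_telescope M t) as hT.
set (U := rsum _ M) in *; set (r := INR M) in *.
pose proof PI_gt_31 as hpi; pose proof PI_4 as hpi4.
assert (hr0 : 0 < / r) by (apply Rinv_0_lt_compat; lra).
assert (hrr : r * / r = 1) by (field; lra).
assert (hr54 : / r <= / 54) by (apply Rinv_le_contravar; lra).
assert (h1' : PI / 6 * / r <= t)
  by (replace (PI / 6 * / r) with (PI / (6 * r)) by (field; lra); exact h1).
set (i := / r) in *.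
assert (edge : Rabs (1 + 2 * cos t) <= 126 / 100 ->
               (1 + 2 * cos t) * U <= 126 / 100 * r).
{ intros hc; apply Rabs_le_bounds in hc.
  apply Rle_trans with (Rabs (1 + 2 * cos t) * Rabs U).
  - rewrite <- Rabs_mult; apply RRle_abs.
  - apply Rmult_le_compat; try apply Rabs_pos; apply Rabs_le; lra. }
pose proof (COS_bound t) as hcb.
assert (ht0 : 0 < t) by nra.
destruct (Rle_lt_dec (PI / 2) t) as [hq|hq].
{ apply edge, Rabs_le.
  assert (cos t <= 0) by (apply cos_le_0; lra); lra. }
assert (hc0 : 0 <= cos t) by (apply cos_ge_0; lra).
destruct (Rle_lt_dec (PI / 2 - 6 / 10 * i) t) as [hq2|hq2].
{ apply edge, Rabs_le.
  assert (cos t <= 6 / 10 * i); [|lra].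
  rewrite <- sin_shift.
  apply Rle_trans with (PI / 2 - t); [|lra].
  left; apply sin_lt_x; lra. }
(* The block sum is at most [w r / (2v)] and [1 + 2 cos t <= 3]; hence the condition
   [3w <= 2 * 1.26 v]. *)
assert (key : forall v w, 0 < v -> 0 <= w -> v * i <= sin (2 * t) ->
   sin (4 * r * t) <= w -> 3 * w <= 252 / 100 * v ->
   (1 + 2 * cos t) * U <= 126 / 100 * r).
{ intros v w hv hw hs hs4 hvw.
  assert (hU2 : 2 * v * U <= w * r).
  { destruct (Rle_lt_dec U 0) as [hn|hp]; [nra|].
    assert (2 * (v * i) * U <= w) by nra.
    replace (2 * v * U) with (2 * (v * i) * U * r)
      by (transitivity (2 * v * U * (r * i)); [ring|rewrite hrr; ring]).
    nra. }
  destruct (Rle_lt_dec U 0) as [hn|hp]; [nra|].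
  assert ((1 + 2 * cos t) * U <= 3 * U) by nra.
  nra. }
(* Here [2t] lies between [z i] and [PI - z i], where the sine is smallest at the ends. *)
assert (mono : forall z, 0 <= z <= 12 / 10 -> z * i <= 2 * t ->
   sin (z * i) <= sin (2 * t)).
{ intros z [hz hz2] hzt.
  destruct (Rle_lt_dec (2 * t) (PI / 2)).
  - apply sin_incr_1; nra.
  - rewrite <- (sin_PI_x (2 * t)); apply sin_incr_1; nra. }
(* With [i <= 1/54], the cubic Taylor term costs less than [i / 10000]. *)
assert (cub : forall z, 1 <= z <= 12 / 10 -> (z - 1 / 10000) * i <= sin (z * i)).
{ intros z hz.
  apply Rle_trans with (z * i - (z * i) ^ 3 / 6); [|apply sin_ge_cubic; nra].
  assert (z ^ 3 <= 12 / 10 * (12 / 10) * (12 / 10)) by nra.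
  assert (i ^ 2 <= / 54 * / 54) by nra.
  assert (z ^ 3 * i ^ 2 / 6 <= 1 / 10000) by nra.
  replace ((z * i) ^ 3 / 6) with (z ^ 3 * i ^ 2 / 6 * i) by field; nra. }
destruct (Rle_lt_dec (6 / 10 * i) t) as [ht|ht].
- apply (key (12 / 10 - 1 / 10000) 1); try lra.
  + eapply Rle_trans; [apply (cub (12 / 10)); lra|].
    apply mono; lra.
  + apply SIN_bound.
(* Now [4rt] lies between [2 PI / 3] and 2.4, so its sine is at most [sqrt 3 / 2], which makes up
   for the weaker bound on [sin (2t)]. *)
- assert (hz : 31 / 30 * i <= 2 * t) by nra.
  apply (key (31 / 30 - 1 / 10000) (8661 / 10000)); try lra.
  + eapply Rle_trans; [apply (cub (31 / 30)); lra|].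
    apply mono; lra.
  + assert (r * t <= 6 / 10) by nra.
    assert (PI / 6 <= r * t) by nra.
    rewrite <- sin_PI_x.
    apply Rle_trans with (sin (PI / 3)).
    * apply sin_incr_1; lra.
    * rewrite sin_PI3.
      assert (sqrt 3 <= 17322 / 10000); [|lra].
      rewrite <- (sqrt_Rsqr (17322 / 10000)) by lra.
      apply sqrt_le_1_alt; unfold Rsqr; lra.
Qed.

Lemma Rabs_cos_prod_parts_le (M : nat) (t : R) : (54 <= M)%nat ->
  PI / (6 * INR M) <= t <= PI -> Rabs (cos_prod (parts M) t) <= (3 / 5) ^ M.
Proof.
intros hM ht.
rewrite <- (Rabs_pos_eq ((3 / 5) ^ M)) by (apply pow_le; lra).
apply Rsqr_le_abs_0; rewrite !Rsqr_pow2, <- pow_mult.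
(* [71 / 100] is [(1 + 0.42) / 2]. *)
eapply Rle_trans; [apply (cos_prod_sqr_le_pow _ _ (71 / 100)); [lra|]|].
- pose proof (cos_sum_parts_le M t hM ht).
  rewrite length_parts, mult_INR; simpl (INR 3); lra.
- rewrite length_parts, (Nat.mul_comm M), !pow_mult.
  (* [0.71 ^ 3 < 0.6 ^ 2] *)
  apply pow_incr; lra.
Qed.

(** For factors in [[0, 1]], one minus the product is at most the sum of the defects, and
    [cos u >= 1 - u^2 / 2] with [u <= b t / 2] bounds each defect. *)
Lemma cos_prod_ge (s : list Z) (b : Z) (t : R) :
  Forall (fun j => 0 <= j <= b)%Z s -> 0 <= t -> IZR b * t <= PI ->
  0 <= cos_prod s t <= 1 /\
  1 - INR (length s) * ((IZR b * t) ^ 2 / 8) <= cos_prod s t.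
Proof.
intros hs ht hb; induction hs as [|j s [hj1 hj2] hs [[IH1 IH2] IH3]]; [simpl; lra|].
cbn [cos_prod fold_right length]; fold (cos_prod s t); rewrite S_INR.
apply IZR_le in hj1; apply IZR_le in hj2.
set (u := IZR j * t / 2).
assert (hu : 0 <= u <= IZR b * t / 2) by (unfold u; nra).
assert (h0 : 0 <= cos u) by (apply cos_ge_0; lra).
pose proof (COS_bound u) as h1.
assert (h2 : 1 - u ^ 2 / 2 <= cos u).
{ replace u with (2 * (u / 2)) at 2 by field.
  rewrite cos_2a_sin.
  assert (0 <= sin (u / 2) <= u / 2); [|nra].
  split; [apply sin_ge_0; lra|].
  destruct (Rle_lt_or_eq_dec 0 (u / 2)) as [h|<-]; [lra| |rewrite sin_0; lra].
  left; now apply sin_lt_x. }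
assert (h3 : u ^ 2 / 2 <= (IZR b * t) ^ 2 / 8) by nra.
set (q := (IZR b * t) ^ 2 / 8) in *.
repeat split; try nra.
Qed.

(** The cube, which comes from [rsum_dominated] with [3M^2] terms, grows per step by at most
    [1.1^3 = 1.331], less than [5/3]. *)
Lemma pow_lt_inv_poly (M : nat) : (54 <= M)%nat ->
  (3 / 5) ^ M * ((3 * INR M ^ 2 + 1) ^ 3 / 3) < 1 / 2.
Proof.
intros hM; induction hM as [|M hM IH].
- rewrite INR_IZR_INZ; change (Z.of_nat 54) with 54%Z; lra.
- assert (hr : 54 <= INR M) by (apply le_INR in hM; simpl in hM; lra).
  rewrite S_INR; set (r := INR M) in *; cbn [pow].
  change (r * (r * 1)) with (r ^ 2) in *.
  assert (p : 0 < (3 / 5) ^ M) by (apply pow_lt; lra).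
  assert (h : 3 * (r + 1) ^ 2 + 1 <= 11 / 10 * (3 * r ^ 2 + 1)) by nra.
  assert (h3 : (3 * (r + 1) ^ 2 + 1) ^ 3 <= (11 / 10 * (3 * r ^ 2 + 1)) ^ 3)
    by (apply pow_incr; split; nra).
  rewrite Rpow_mult_distr in h3.
  set (x := (3 * (r + 1) ^ 2 + 1) ^ 3) in *.
  set (y := (3 * r ^ 2 + 1) ^ 3) in *.
  change (3 / 5 * (3 / 5) ^ M * (x / 3) < 1 / 2).
  assert (0 <= y) by (unfold y; apply pow_le; nra).
  nra.
Qed.

Lemma parts_diff_center (M : nat) (n : Z) : (54 <= M)%nat ->
  (3 * (Z.of_nat M - 1) ^ 2 < n <= 3 * Z.of_nat M ^ 2)%Z ->
  (1 <= subset_diff (parts M) n)%Z.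
Proof.
intros hM hn.
enough (0 < subset_diff (parts M) n)%Z by lia.
assert (hr : 54 <= INR M) by (apply le_INR in hM; simpl in hM; lra).
assert (hZ : IZR (Z.of_nat M) = INR M) by (symmetry; apply INR_IZR_INZ).
(* The degree is [2H], so roots of unity of order [2H + 1] separate all exponents. *)
set (H := (3 * (M * M))%nat).
assert (hH : INR H = 3 * INR M ^ 2)
  by (unfold H; rewrite !mult_INR; simpl; ring).
assert (hHZ : Z.of_nat H = (3 * Z.of_nat M ^ 2)%Z) by (unfold H; lia).
(* The width of the window gives [y <= 6r] below, so that [y t <= PI] whenever [t <= PI / (6r)]. *)
assert (hx : 0 <= 3 * INR M ^ 2 - IZR n <= 6 * INR M - 4).
{ rewrite <- hZ; split.
  - apply Rge_le, Rge_minus, Rle_ge; rewrite pow_IZR, <- mult_IZR.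
    change (Z.of_nat 2) with 2%Z; apply IZR_le; lia.
  - destruct hn as [hn _]; apply Zlt_le_succ, IZR_le in hn.
    unfold Z.succ in hn.
    rewrite plus_IZR, mult_IZR in hn.
    replace ((Z.of_nat M - 1) ^ 2)%Z
      with ((Z.of_nat M - 1) * (Z.of_nat M - 1))%Z in hn by ring.
    rewrite mult_IZR, minus_IZR in hn; nra. }
pose proof (subset_diff_fourier (parts M) H n (parts_nonneg M)) as F.
cbv zeta in F.
rewrite lsum_parts, hHZ in F.
specialize (F ltac:(lia) ltac:(split; [nia|lia])).
replace (IZR (6 * Z.of_nat M ^ 2)) with (6 * INR M ^ 2) in F
  by (rewrite mult_IZR, <- hZ, pow_IZR; reflexivity).
rewrite hH in F.
set (r := INR M) in *.
set (y := 6 * r ^ 2 / 2 - IZR n + / 2) in F.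
assert (hy : / 2 <= y <= 6 * r) by (unfold y; lra).
set (L := 2 * (3 * r ^ 2) + 1) in F.
assert (hL : L = 6 * r ^ 2 + 1) by (unfold L; ring).
set (t := fun k => 2 * PI * INR (S k) / L).
set (f := fun k => cos_prod (parts M) (t k) * (sin (t k / 2) * sin (y * t k))).
change (rsum _ H) with (rsum f H) in F.
pose proof PI_RGT_0 as hpi; pose proof PI_4 as hpi4.
assert (hL0 : 0 < L) by nra.
assert (ht : forall k, t k = INR (S k) * t 0%nat)
  by (intros k; unfold t; simpl (INR 1); field; lra).
set (v := t 0%nat).
assert (hv : v * L = 2 * PI) by (unfold v, t; simpl (INR 1); field; lra).
assert (hv' : 6 * (r ^ 2 * v) + v = 2 * PI) by (rewrite <- hv, hL; ring).
assert (hv0 : 0 < v) by nra.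
assert (hrv : 0 < r * v) by nra.
assert (hvr : 6 * r * v < PI).
{ apply (Rmult_lt_reg_r L); [exact hL0|].
  replace (6 * r * v * L) with (PI * (12 * r)) by (rewrite Rmult_assoc, hv; ring).
  apply Rmult_lt_compat_l; nra. }
set (A := sin (v / 2) * sin (y * v)).
assert (hA1 : 0 < sin (v / 2)) by (apply sin_gt_0; nra).
assert (hA2 : 0 < sin (y * v)).
{ apply sin_gt_0; nra. }
assert (hA : 0 < A) by (unfold A; nra).
assert (hb : IZR (4 * Z.of_nat M - 1) = 4 * r - 1)
  by (rewrite minus_IZR, mult_IZR, hZ; reflexivity).
assert (f0 : A / 2 <= f 0%nat).
{ unfold f; fold v; fold A.
  destruct (cos_prod_ge (parts M) (4 * Z.of_nat M - 1) v (parts_le M)) as [_ h].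
  - lra.
  - rewrite hb; nra.
  - rewrite length_parts, mult_INR, hb in h; fold r in h; simpl (INR 3) in h.
    (* With [3r] parts the loss is then at most [3 * (4/3) / 8 = 1/2]. *)
    assert (hq : r * ((4 * r - 1) * v) ^ 2 <= 4 / 3).
    { assert (h4 : ((4 * r - 1) * v) * (3 * r) <= 16).
      { replace (((4 * r - 1) * v) * (3 * r))
          with (12 * (r ^ 2 * v) - 3 * (r * v)) by ring; lra. }
      set (z := (4 * r - 1) * v) in *.
      assert (hz : 0 <= z) by (unfold z; apply Rmult_le_pos; lra).
      assert (hz2 : (z * (3 * r)) ^ 2 <= 16 ^ 2)
        by (apply pow_incr; split; [apply Rmult_le_pos|]; lra).
      assert (hz3 : 0 <= r * z ^ 2) by (apply Rmult_le_pos; [lra|apply pow2_ge_0]).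
      replace ((z * (3 * r)) ^ 2) with (9 * r * (r * z ^ 2)) in hz2 by ring.
      nra. }
    assert (1 / 2 <= cos_prod (parts M) v) by nra.
    nra. }
assert (fk : forall k, (k <= H - 1)%nat ->
   - (A * (3 / 5) ^ M * INR (S k) ^ 2) <= f k).
{ intros k hk.
  assert (hS : 0 < INR (S k)) by (apply lt_0_INR; lia).
  assert (p : 0 < (3 / 5) ^ M) by (apply pow_lt; lra).
  assert (hneg : - (A * (3 / 5) ^ M * INR (S k) ^ 2) <= 0)
    by (assert (0 < A * (3 / 5) ^ M * INR (S k) ^ 2)
          by (repeat apply Rmult_lt_0_compat; try apply pow_lt; lra); lra).
  assert (hk' : INR (S k) <= 3 * r ^ 2).
  { rewrite <- hH; apply le_INR; assert (1 <= H)%nat by (unfold H; nia); lia. }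
  assert (htpi : t k <= PI) by (rewrite ht; fold v; nra).
  assert (ht0 : 0 < t k) by (rewrite ht; fold v; nra).
  (* Up to the threshold the cosine product and both sines are nonnegative; beyond it the product is
     at most [(3/5)^M], and each sine is at most [k + 1] times that of the first term. *)
  destruct (Rle_lt_dec (t k) (PI / (6 * r))) as [hs|hs].
  - apply (Rle_trans _ 0); [exact hneg|].
    assert (hs' : 6 * r * t k <= PI).
    { apply Rmult_le_compat_l with (r := 6 * r) in hs; [|lra].
      replace (6 * r * (PI / (6 * r))) with PI in hs by (field; lra); lra. }
    destruct (cos_prod_ge (parts M) (4 * Z.of_nat M - 1) (t k) (parts_le M))
      as [[h _] _]; [lra|rewrite hb; nra|].
    unfold f; repeat apply Rmult_le_pos; auto.
    + apply sin_ge_0; lra.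
    + apply sin_ge_0; nra.
  - apply Rle_trans with (- Rabs (f k)).
    2:{ pose proof (Rle_abs (- f k)) as h; rewrite Rabs_Ropp in h; lra. }
    apply Ropp_le_contravar; unfold f.
    rewrite !Rabs_mult.
    pose proof (Rabs_cos_prod_parts_le M (t k) hM) as hc.
    fold r in hc; specialize (hc (conj (Rlt_le _ _ hs) htpi)).
    pose proof (Rabs_sin_mult (S k) (v / 2)) as s1.
    pose proof (Rabs_sin_mult (S k) (y * v)) as s2.
    replace (INR (S k) * (v / 2)) with (t k / 2) in s1
      by (rewrite (ht k); fold v; field).
    replace (INR (S k) * (y * v)) with (y * t k) in s2
      by (rewrite (ht k); fold v; ring).
    rewrite (Rabs_pos_eq (sin (v / 2))) in s1 by lra.
    rewrite (Rabs_pos_eq (sin (y * v))) in s2 by lra.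
    replace (A * (3 / 5) ^ M * INR (S k) ^ 2) with
      ((3 / 5) ^ M * ((INR (S k) * sin (v / 2)) * (INR (S k) * sin (y * v))))
      by (unfold A; ring).
    repeat apply Rmult_le_compat; auto; try apply Rabs_pos.
    apply Rmult_le_pos; apply Rabs_pos. }
assert (hH1 : H = S (H - 1)) by (assert (1 <= H)%nat by (unfold H; nia); lia).
assert (hsum : 0 < rsum f H).
{ rewrite hH1.
  eapply Rlt_le_trans; [|apply (rsum_dominated f (A / 2) _ _ f0 fk)].
  - rewrite <- hH1, S_INR, hH.
    pose proof (pow_lt_inv_poly M hM) as hp; fold r in hp; nra.
  - apply Rmult_le_pos; [lra|apply pow_le; lra]. }
apply lt_IZR.
assert (0 < 2 ^ length (parts M)) by (apply pow_lt; lra).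
assert (0 < L * IZR (subset_diff (parts M) n)).
{ rewrite F; repeat apply Rmult_lt_0_compat; auto; lra. }
nra.
Qed.

(* Combining the ranges of [M] and [n] *)
Close Scope R_scope.
Local Open Scope Z_scope.

(** Beyond the computed cases, the previous range is inherited through the recursion and the new
    central window comes from the Fourier estimate. *)
Lemma parts_diff_ge1 (M : nat) : (5 <= M)%nat ->
  forall n, 8 <= n <= 3 * Z.of_nat M ^ 2 -> 1 <= subset_diff (parts M) n.
Proof.
induction M as [|M IH]; intros hM n hn; [lia|].
destruct (Nat.le_gt_cases (S M) 54) as [h|h].
- pose proof (parts_diff_upto_54 (S M) n) as hc.
  rewrite (proj2 (Nat.leb_le 5 (S M)) hM) in hc; apply hc; lia.
- destruct (Z.le_gt_cases n (3 * Z.of_nat M ^ 2)).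
  + apply parts_diff_step; [lia|apply IH; lia|lia].
  + apply parts_diff_center; lia.
Qed.

Lemma parts_diff_ge0 (M : nat) (n : Z) : (0 < M)%nat ->
  1 <= n <= 3 * Z.of_nat M ^ 2 -> n <> 4 -> 0 <= subset_diff (parts M) n.
Proof.
intros hM hn n4.
destruct (Z.le_gt_cases 8 n) as [h8|h8].
- destruct (Nat.le_gt_cases 5 M) as [h5|h5].
  + pose proof (parts_diff_ge1 M h5 n); lia.
  + pose proof (parts_diff_upto_54 M n) as hc.
    rewrite (proj2 (Nat.leb_gt 5 M) h5) in hc; lia.
- destruct (Nat.eq_dec M 1) as [->|h1].
  (* A single block has not yet reached the stable initial coefficients, but its range ends at 3. *)
  + assert (n = 1 \/ n = 2 \/ n = 3) as [->|[->| ->]] by lia; now vm_compute.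
  + destruct (parts_diff_small M) as (_ & c1 & c2 & c3 & _ & c5 & c6 & c7); [lia|].
    assert (n = 1 \/ n = 2 \/ n = 3 \/ n = 5 \/ n = 6 \/ n = 7) as D by lia.
    destruct D as [->|[->|[->|[->|[->| ->]]]]]; lia.
Qed.

Close Scope Z_scope.

(** * Coefficients of the polynomials *)

Require Import Defs.
From mathcomp Require Import all_boot all_order all_algebra.
From mathcomp Require Import zify.

Import GRing.Theory.
Local Open Scope ring_scope.

(** Multiplication by [1 + 'X^j] follows the recursion of [subset_count]; for [n < j] the shifted
    coefficient is 0, as is the count at a negative index. *)
Lemma coef_mul_part (p : {poly int}) (s : seq Z) (j : nat) (z : Z) :
  List.Forall (Z.le 0) s -> z = Z.of_nat j ->
  (forall n, ssrZ.Z_of_int p`_n = subset_count s (Z.of_nat n)) ->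
  forall n, ssrZ.Z_of_int (p * (1 + 'X^j))`_n =
            subset_count (z :: s) (Z.of_nat n).
Proof.
have ZD (x y : int) :
    ssrZ.Z_of_int (x + y) = Z.add (ssrZ.Z_of_int x) (ssrZ.Z_of_int y) by lia.
move=> hs -> hp n; rewrite mulrDr mulr1 coefD.
apply: etrans (ZD _ _) _; rewrite /= hp; congr Z.add.
rewrite coefMXn; case: ltnP => hj; last by rewrite hp; congr subset_count; lia.
rewrite subset_count_neg //; lia.
Qed.

Lemma d4_subset_count (m n : nat) :
  ssrZ.Z_of_int (d4 m n) = subset_count (parts m.+1) (Z.of_nat n).
Proof.
rewrite /d4 /P4; elim: m.+1 n => [|M IH] n.
  by rewrite big_ord0 coef1; case: n.
(* [parts] lists the smallest part of a block first, so its factor has to be multiplied last. *)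
have E (p a b c : {poly int}) : p * (a * b * c) = p * c * b * a.
  by rewrite -!mulrA; congr (_ * _); rewrite mulrC [b * c]mulrC -mulrA.
have hs := parts_nonneg M; rewrite big_ord_recr [LHS]/= E; cbn [parts].
do 3 (apply: coef_mul_part; [by repeat (constructor; try lia)|lia|]).
exact: IH.
Qed.

Theorem theorem1p1 (m : nat) :
  (forall n : nat, (1 <= n <= 3 * m.+1 ^ 2)%N -> n <> 4%N ->
     d4 m n >= d4 m n.-1) /\
  (forall n : nat, (3 * m.+1 ^ 2 <= n <= N4 m - 1)%N -> n <> (N4 m - 4)%N ->
     d4 m n >= d4 m n.+1).
Proof.
have eN : lsum (parts m.+1) = Z.of_nat (N4 m) by rewrite lsum_parts /N4; lia.
have hM : Peano.lt 0 m.+1 by lia.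
split=> n hn n4.
  have hc : Z.le 0 (subset_diff (parts m.+1) (Z.of_nat n)).
    by apply: parts_diff_ge0 => //; lia.
  move: hc; rewrite /subset_diff (_ : Z.sub (Z.of_nat n) 1 = Z.of_nat n.-1).
    by rewrite -!d4_subset_count; lia.
  by lia.
(* The second half is the first one at [N4 m - n], reflected; the excluded index [N4 m - 4] becomes
   4. *)
have hc : Z.le 0 (subset_diff (parts m.+1) (Z.of_nat (N4 m - n))).
  by apply: parts_diff_ge0 => //; rewrite /N4 in hn n4 *; lia.
move: hc; rewrite /subset_diff.
rewrite -(subset_count_sym _ (Z.of_nat _)) -(subset_count_sym _ (Z.sub _ 1)) eN.
rewrite (_ : Z.sub _ (Z.of_nat _) = Z.of_nat n); last by lia.
rewrite (_ : Z.sub _ (Z.sub _ _) = Z.of_nat n.+1); last by lia.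
by rewrite -!d4_subset_count; lia.
Qed.
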